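(* Fix integers $n\ge 1$ and $0\le m\le N$, where $N=\binom{n}{2}$. For every integer $i\ge 1$ there exist rational numbers $c_1,\dots,c_i$ (depending on $n,m,i$) such that \[ \Delta_i=\sum_{j=1}^{i} c_j\,\Delta_1^{\,j}; \] that is, $\Delta_i$ can be written in terms of $\Delta_1$ alone (with no identity term).
   Context: All graphs are simple. For a graph $G$ on a fixed set of $n$ vertices with $m$ edges, $N=\binom{n}{2}$. For $j\ge 0$, the modified $j$-deck $MD_j(G)$ is the multiset of graphs $G-X+Y$ where $X$ ranges over all $j$-subsets of $E(G)$ and $Y$ over all $j$-subsets of the set of non-edges of $G-X$ (i.e. $j$ edges are removed in all possible ways and then $j$ edges, not necessarily new, are added in all possible ways). Let $G_1,G_2,\dots$ represent the isomorphism classes of graphs with $n$ vertices and $m$ edges. $\Delta_j$ is the square matrix whose $(k,l)$ entry is the number of members of $MD_j(G_l)$ isomorphic to $G_k$; products are matrix products. *)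

(* Defs.v *)
From mathcomp Require Import all_boot all_algebra.
From mathcomp Require Import fingroup perm.

Set Implicit Arguments.
Unset Strict Implicit.
Unset Printing Implicit Defensive.

(* The 'C(n, 2) potential edges on the vertex set 'I_n; a simple graph is a
   set of them, so that [~: G] is the set of non-edges of G and [#|G|] its
   number of edges. *)
Definition edge (n : nat) := {e : {set 'I_n} | #|e| == 2}.

Definition graph (n : nat) := {set edge n}.

Definition adj n (G : graph n) : rel 'I_n :=
  fun u v => [exists e in G, val e == [set u; v]].

Definition iso n (G H : graph n) : bool :=
  [exists s : 'S_n, forall u, forall v, adj H (s u) (s v) == adj G u v].

Definition ksubsets (T : finType) (j : nat) (A : {set T}) : {set {set T}} :=
  [set X : {set T} | (X \subset A) && (#|X| == j)].

(* The multiset MD_j(G), listed with multiplicity: one item per pair (X, Y). *)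
Definition modified_deck n (j : nat) (G : graph n) : seq (graph n) :=
  [seq (G :\: X) :|: Y | X <- enum (ksubsets j G),
                         Y <- enum (ksubsets j (~: (G :\: X)))].

(* G 0, ..., G r.-1 is a system of representatives, without repetition, of the
   isomorphism classes of graphs with n vertices and m edges; r is then
   necessarily the number of these classes. *)
Definition represents_classes (n m r : nat) (G : 'I_r -> graph n) : Prop :=
  [/\ forall k, #|G k| = m,
      forall k l, iso (G k) (G l) -> k = l
    & forall H : graph n, #|H| = m -> exists k, iso H (G k)].

Definition Delta n r (G : 'I_r -> graph n) (j : nat) : 'M[rat]_r :=
  \matrix_(k, l) (count (fun H => iso H (G k)) (modified_deck j (G l)))%:R%R.

(* Main.v *)
(* Write [u] and [d] for the operators on functions of edge sets that sum over
   all additions, respectively all removals, of one edge. Summing over the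
   modified j-deck is [(j!)^-2 d^j u^j], and on graphs with k edges
   [u d - d u] is the scalar N - 2k. Hence [u^j d] equals [d u^j] plus a
   multiple of [u^(j-1)], which yields
   Delta_1 Delta_j = (j+1)^2 Delta_(j+1) + j (N - 2m + j + 1) Delta_j.
   Induction from Delta_1 then never produces an identity term. *)
Require Import Defs.
From mathcomp Require Import all_boot all_algebra.
From mathcomp Require Import fingroup perm ring.

Set Implicit Arguments.
Unset Strict Implicit.
Unset Printing Implicit Defensive.

Import GRing.Theory Num.Theory.
Local Open Scope ring_scope.

(** * Calculus of the operators adding and removing one element *)

Section SetOperators.
Variable T : finType.
Implicit Types (f g : {set T} -> rat) (A B : {set T}) (j : nat).

Definition del f A : rat := \sum_(x in A) f (A :\ x).
Definition add f A : rat := \sum_(x in ~: A) f (x |: A).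

(** Only sets with [j] elements fewer than [A] are reached, so a coefficient depending on the size
    of the set becomes a constant. *)
Lemma eq_iter_del j g g' A :
  (forall B, (#|B| + j)%N = #|A| -> g B = g' B) ->
  iter j del g A = iter j del g' A.
Proof.
elim: j A => [|j IHj] A eqg /=; first by apply: eqg; rewrite addn0.
apply: eq_bigr => x xA; apply: IHj => B cardB; apply: eqg.
by rewrite (cardsD1 x A) xA -cardB addnS.
Qed.

(** Adding to [A] is removing from its complement, so facts on [del] transfer to [add]. *)
Lemma iter_add_setC j f A :
  iter j add f A = iter j del (fun B => f (~: B)) (~: A).
Proof.
elim: j A => [|j IHj] A /=; first by rewrite setCK.
by apply: eq_bigr => x _; rewrite IHj setCU setIC -setDE.
Qed.

(** The elements of a [j]-set [X] can be removed in [j!] orders. *)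
Lemma iter_del_ksubsets j g A :
  iter j del g A = j`!%:R * \sum_(X in ksubsets j A) g (A :\: X).
Proof.
elim: j A => [|j IHj] A.
  rewrite (big_pred1 set0) ?setD0 ?mul1r // => X.
  by rewrite inE cards_eq0 /= andbC; case: eqP => [->|]; rewrite ?sub0set.
rewrite iterS /del; under eq_bigr => x _ do rewrite IHj.
rewrite -big_distrr /= factS mulnC natrM -mulrA; congr (_ * _).
(* Double counting of pairs [x \in X]: each [X] gives [j.+1] of them, and for fixed [x] the set
   [X :\ x] runs over the [j]-subsets of [A :\ x]. *)
transitivity (\sum_(X in ksubsets j.+1 A) \sum_(x in X) g (A :\: X)); last first.
  rewrite big_distrr /=; apply: eq_bigr => X; rewrite inE => /andP[_ /eqP cX].
  by rewrite sumr_const cX mulr_natl.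
rewrite (exchange_big_dep (mem A)) /=; last first.
  by move=> X x; rewrite inE => /andP[/subsetP sXA _]; apply: sXA.
apply: eq_bigr => x xA.
rewrite [RHS](reindex_onto (fun X => x |: X) (fun X => X :\ x)) /=; last first.
  by move=> X /andP[_ xX]; rewrite setD1K.
apply: eq_big => [X|X _]; last by rewrite setDDl.
rewrite !inE eqxx andbT subsetD1 subUset sub1set xA cardsU1 /=.
have [xX|xX] := boolP (x \in X); last by rewrite setU1K // eqxx !andbT eqSS.
rewrite andbF; symmetry; apply/negbTE; rewrite negb_and; apply/orP; right.
by apply: contraL xX => /eqP<-; rewrite setD11.
Qed.

(** Both compositions contain the sum [S] over exchanges of an [x] in [A] for a [y] outside. Undoing
    the first move gives [f A] a further [#|A|] times for [del (add f)] and [#|~: A|] times for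
    [add (del f)]. *)
Lemma add_del f A :
  add (del f) A = del (add f) A + (#|T|%:R - 2 * #|A|%:R) * f A.
Proof.
pose S := \sum_(x in A) \sum_(y in ~: A) f (y |: (A :\ x)).
have delE : del (add f) A = #|A|%:R * f A + S.
  rewrite mulr_natl -sumr_const -big_split; apply: eq_bigr => x xA.
  by rewrite /add setCD (setUC (~: A)) big_setU1 ?inE ?xA //= setD1K.
have addE : add (del f) A = #|~: A|%:R * f A + S.
  rewrite /S exchange_big /= mulr_natl -sumr_const -big_split.
  apply: eq_bigr => y; rewrite inE => yA.
  rewrite /del big_setU1 //= setU1K //; congr (_ + _).
  apply: eq_bigr => x xA; congr (f _); rewrite setDUl; congr (_ :|: _).
  by apply/setDidPl; rewrite disjoints1 inE; apply: contraNneq yA => ->.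
have /(congr1 (fun k => k%:R : rat)) := cardsC A; rewrite natrD => <-.
by rewrite addE delE; ring.
Qed.

(** The coefficient is the sum of the scalars [#|T| - 2 (#|A| + k)] for [k < j]. At [j = 0] it
    vanishes, so the value of [j.-1] is harmless. *)
Lemma iter_add_del j f A :
  iter j add (del f) A = del (iter j add f) A
    + j%:R * (#|T|%:R - 2 * #|A|%:R - j%:R + 1) * iter j.-1 add f A.
Proof.
elim: j A => [|j IHj] A; first by rewrite !mul0r addr0.
(* The induction hypothesis is used at [y |: A], one element larger, which turns [+ 1] into
   [- 1]. *)
have -> : iter j.+1 add (del f) A = add (del (iter j add f)) A
    + j%:R * (#|T|%:R - 2 * #|A|%:R - j%:R - 1) * iter j add f A.
  rewrite iterS {1}/add; under eq_bigr => y _ do rewrite IHj.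
  rewrite big_split /=; congr (_ + _).
  case: j {IHj} => [|j]; first by rewrite !mul0r big1 // => y _; rewrite !mul0r.
  rewrite big_distrr /=; apply: eq_bigr => y; rewrite inE => yA.
  by rewrite cardsU1 yA add1n -!natr1 -/(iter _ _ _); ring.
by rewrite add_del /= -natr1; ring.
Qed.

Lemma eq_iter_add j f g A : f =1 g -> iter j add f A = iter j add g A.
Proof.
by move=> eqfg; rewrite !iter_add_setC; apply: eq_iter_del => B _; apply: eqfg.
Qed.

Lemma iter_del_linear j (c : rat) f g A :
  iter j del (fun B => f B + c * g B) A = iter j del f A + c * iter j del g A.
Proof.
rewrite !iter_del_ksubsets big_split /= -big_distrr /=.
by ring.
Qed.

(** The sum over a modified [j]-deck, for subsets of any finite type: graphs enter only through the
    choice of [f]. *)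
Definition deck_sum j f A : rat :=
  \sum_(X in ksubsets j A) \sum_(Y in ksubsets j (~: (A :\: X)))
    f ((A :\: X) :|: Y).

(** The outer operator acts on the set first, so removals precede additions. The factor counts the
    orderings of [X] and of [Y]. *)
Lemma iter_del_add j f A :
  iter j del (iter j add f) A = j`!%:R ^+ 2 * deck_sum j f A.
Proof.
rewrite iter_del_ksubsets exprS expr1 -mulrA; congr (_ * _).
rewrite big_distrr /=; apply: eq_bigr => X _.
rewrite iter_add_setC iter_del_ksubsets; congr (_ * _).
by apply: eq_bigr => Y _; rewrite setCD setCK setUC.
Qed.

Lemma sqr_fact_neq0 j : j`!%:R ^+ 2 != 0 :> rat.
Proof. by rewrite expf_neq0 // pnatr_eq0 -lt0n fact_gt0. Qed.

(** Up to the factor [j! ^ 2], the left side is [j] removals, [j] additions, one removal and one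
    addition. Moving the last removal ahead of the [j] additions gives the two terms on the
    right. *)
Lemma deck_sum1 j f A :
  deck_sum j (deck_sum 1 f) A = j.+1%:R ^+ 2 * deck_sum j.+1 f A
    + j%:R * (#|T|%:R - 2 * #|A|%:R + j%:R + 1) * deck_sum j f A.
Proof.
have deck1E B : deck_sum 1 f B = del (add f) B.
  by have := iter_del_add 1 f B; rewrite expr1n mul1r.
apply: (mulfI (sqr_fact_neq0 j)); rewrite -iter_del_add.
(* The coefficient of [iter_add_del] at a set [B] of size [#|A| - j]. *)
pose c : rat := j%:R * (#|T|%:R - 2 * #|A|%:R + j%:R + 1).
pose g B := del (iter j add (add f)) B + c * iter j.-1 add (add f) B.
rewrite (_ : iter j del _ A = iter j del g A); last first.
  apply: eq_iter_del => B /(congr1 (fun k => k%:R : rat)); rewrite natrD => cB.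
  rewrite (eq_iter_add _ _ deck1E) iter_add_del /g /c -cB.
  by congr (_ + _ * _); ring.
rewrite iter_del_linear.
have -> : iter j del (del (iter j add (add f))) A =
    iter j.+1 del (iter j.+1 add f) A by rewrite !iterSr.
rewrite iter_del_add factS natrM mulrDr; congr (_ + _); first by ring.
rewrite /c; case: j @c @g => [|j] _ _; first by rewrite !mul0r mulr0.
by rewrite -iterSr iter_del_add; ring.
Qed.

(** * Invariance of deck sums under permutations, and preservation of size *)

Lemma del_imset (p : {perm T}) f A :
  del f (p @: A) = del (fun B => f (p @: B)) A.
Proof.
rewrite /del big_imset /=; last by move=> x y _ _; apply: perm_inj.
apply: eq_bigr => x _; congr (f _); apply/setP=> y.
rewrite -[y](permKV p) !inE (inj_eq perm_inj) !mem_imset ?inE //; apply: perm_inj.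
Qed.

Lemma iter_del_imset (p : {perm T}) j f A :
  iter j del f (p @: A) = iter j del (fun B => f (p @: B)) A.
Proof.
elim: j A => //= j IHj A; rewrite del_imset.
by apply: eq_bigr => x _; apply: IHj.
Qed.

Lemma iter_add_imset (p : {perm T}) j f A :
  iter j add f (p @: A) = iter j add (fun B => f (p @: B)) A.
Proof.
have imsetC B : p @: (~: B) = ~: (p @: B).
  apply/setP=> y; rewrite -[y](permKV p) !inE !mem_imset ?inE //; exact: perm_inj.
rewrite !iter_add_setC -imsetC iter_del_imset.
by apply: eq_iter_del => B _; rewrite imsetC.
Qed.

Lemma deck_sum_imset (p : {perm T}) j f A :
  deck_sum j f (p @: A) = deck_sum j (fun B => f (p @: B)) A.
Proof.
apply: (mulfI (sqr_fact_neq0 j)); rewrite -!iter_del_add iter_del_imset.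
by apply: eq_iter_del => B _; apply: iter_add_imset.
Qed.

Lemma eq_deck_sum j f g A :
  (forall B, #|B| = #|A| -> f B = g B) -> deck_sum j f A = deck_sum j g A.
Proof.
move=> eqfg; apply: eq_bigr => X; rewrite inE => /andP[XA /eqP cX].
apply: eq_bigr => Y; rewrite inE => /andP[YA /eqP cY]; apply: eqfg.
rewrite -(cardsID X A) (setIidPr XA) cX -cY addnC cardsU.
suff -> : #|(A :\: X) :&: Y| = 0%N by rewrite subn0.
by apply/eqP; rewrite cards_eq0 setIC setI_eq0 disjoints_subset.
Qed.

End SetOperators.

(** * Isomorphism as an action on edges, and the matrix recurrence *)

Section Isomorphism.
Variable n : nat.
Implicit Types (s : 'S_n) (e : edge n) (G H K : graph n).

Lemma edge_imset_subproof s e : #|s @: val e| == 2.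
Proof. by rewrite card_imset ?(valP e) //; apply: perm_inj. Qed.

Definition edge_imset s e : edge n := Sub (s @: val e) (edge_imset_subproof s e).

Lemma edge_imset_inj s : injective (edge_imset s).
Proof.
move=> e1 e2 /(congr1 val) /= eq_s; apply: val_inj.
exact: (imset_inj (@perm_inj _ s)) eq_s.
Qed.

(** The induced action on potential edges makes isomorphism an orbit relation on edge sets, to which
    [deck_sum_imset] applies. *)
Definition edge_perm s : {perm edge n} := perm (@edge_imset_inj s).

Lemma adj_edge_perm s G u v : adj (edge_perm s @: G) (s u) (s v) = adj G u v.
Proof.
have sub2 : [set s u; s v] = s @: [set u; v] by rewrite imsetU1 imset_set1.
apply/existsP/existsP=> -[e /andP[eG /eqP ve]].
  case/imsetP: eG ve => e' e'G ->; rewrite permE /= sub2 => eq_s.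
  by exists e'; rewrite e'G (imset_inj (@perm_inj _ s) eq_s) /=.
exists (edge_perm s e); rewrite imset_f //= permE /= ve sub2.
by rewrite eqxx.
Qed.

Lemma adj_inj G H : (forall u v, adj G u v = adj H u v) -> G = H.
Proof.
move=> eqGH; apply/setP=> e.
have /cards2P[u [v [_ ve]]] := valP e.
have adjE K : adj K u v = (e \in K).
  apply/existsP/idP=> [[e' /andP[e'K]]|eK]; last by exists e; rewrite eK ve /=.
  by rewrite -ve => /eqP/val_inj <-.
by rewrite -!adjE.
Qed.

Lemma isoP G H : reflect (exists s, H = edge_perm s @: G) (iso G H).
Proof.
apply: (iffP existsP) => -[s].
  move=> /forallP sGH; exists s; apply: adj_inj => u v.
  have /forallP/(_ (s^-1 v)%g)/eqP := sGH (s^-1 u)%g.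
  by rewrite !permKV => ->; rewrite -(adj_edge_perm s G) !permKV.
move=> ->; exists s; apply/forallP=> u; apply/forallP=> v.
by rewrite adj_edge_perm.
Qed.

Lemma iso_edge_perm s G H : iso (edge_perm s @: G) H = iso G H.
Proof.
apply/existsP/existsP=> -[t /forallP isot].
  exists (s * t)%g; apply/forallP=> u; apply/forallP=> v; rewrite !permM.
  by have /forallP/(_ (s v)) := isot (s u); rewrite adj_edge_perm.
exists (s^-1 * t)%g; apply/forallP=> u; apply/forallP=> v; rewrite !permM.
have /forallP/(_ (s^-1 v)%g)/eqP -> := isot (s^-1 u)%g.
by rewrite -(adj_edge_perm s) !permKV.
Qed.

Definition iso_ind H G : rat := (iso G H)%:R.

Lemma deck_sum_iso j H G K :
  iso G K -> deck_sum j (iso_ind H) G = deck_sum j (iso_ind H) K.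
Proof.
case/isoP=> s ->; rewrite deck_sum_imset; apply: eq_deck_sum => B _.
by rewrite /iso_ind iso_edge_perm.
Qed.

Lemma count_modified_deck j H G :
  (count (fun K => iso K H) (modified_deck j G))%:R = deck_sum j (iso_ind H) G.
Proof.
rewrite -sum1_count natr_sum big_mkcond big_allpairs_dep /= big_enum.
apply: eq_bigr => X _; rewrite big_enum /=; apply: eq_bigr => Y _.
by rewrite /iso_ind; case: iso.
Qed.

(** Grouping the members of the [j]-deck of [G l] by isomorphism class identifies the product entry
    with an iterated deck sum, which [deck_sum1] evaluates. *)
Lemma Delta1_mul m r (G : 'I_r -> graph n) j : represents_classes m G ->
  Delta G 1 *m Delta G j = j.+1%:R ^+ 2 *: Delta G j.+1
    + (j%:R * (#|{: edge n}|%:R - 2 * m%:R + j%:R + 1)) *: Delta G j.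
Proof.
case=> cardG isoG_inj ex_iso; apply/matrixP=> k l; rewrite !mxE.
rewrite !count_modified_deck -(cardG l) -deck_sum1.
transitivity (deck_sum j (fun H =>
    \sum_p deck_sum 1 (iso_ind (G k)) (G p) * iso_ind (G p) H) (G l)).
  rewrite /deck_sum; under [RHS]eq_bigr => X _ do rewrite exchange_big /=.
  rewrite exchange_big /=; apply: eq_bigr => p _; rewrite !mxE.
  rewrite !count_modified_deck {2}/deck_sum big_distrr /=; apply: eq_bigr => X _.
  by rewrite big_distrr.
(* Each [H] in the deck has [m] edges, hence exactly one representative, and the sum over classes
   reduces to that term. *)
apply: eq_deck_sum => H; rewrite cardG => /ex_iso[p isoHp].
rewrite (bigD1 p) //= /iso_ind isoHp mulr1 big1 => [|q qp].
  by rewrite addr0 -/(iso_ind _) (deck_sum_iso _ _ isoHp).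
case isoHq: (iso H (G q)); last by rewrite mulr0.
case/isoP: isoHp isoG_inj => s Gp_def /(_ p q); rewrite {1}Gp_def iso_edge_perm.
by move=> /(_ isoHq) pq; rewrite pq eqxx in qp.
Qed.
End Isomorphism.

Theorem theorem2p4 (n m i : nat) (hn : (1 <= n)%N) (hm : (m <= 'C(n, 2))%N)
    (hi : (1 <= i)%N) :
  exists c : nat -> rat,
    forall (r : nat) (G : 'I_r -> graph n), represents_classes m G ->
      Delta G i = \sum_(1 <= j < i.+1) c j *: Delta G 1 ^+ j.
Proof.
case: i hi => // i _; elim: i => [|i [c IHc]].
  by exists (fun=> 1) => r G _; rewrite big_nat1 expr1 scale1r.
(* [a] and [b] come from solving the recurrence [Delta1_mul] at [i.+1] for [Delta G i.+2]. *)
pose a : rat := i.+2%:R ^- 2.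
pose b : rat := i.+1%:R * (#|{: edge n}|%:R - 2 * m%:R + i.+1%:R + 1).
(* Multiplication by [Delta G 1] shifts the coefficients by one. The guards discard [c 0] and
   [c i.+2], on which the induction hypothesis says nothing. *)
exists (fun j => a * ((if (1 < j)%N then c j.-1 else 0)
                      - (if (j < i.+2)%N then b * c j else 0))) => r G classG.
have -> : Delta G i.+2
    = a *: (Delta G 1 *m Delta G i.+1) - (a * b) *: Delta G i.+1.
  rewrite (Delta1_mul _ classG) scalerDr !scalerA addrK mulVf ?scale1r //.
  by rewrite expf_neq0 // pnatr_eq0.
under [RHS]eq_bigr => j _ do rewrite -scalerA scalerBl scalerBr.
rewrite sumrB (IHc _ _ classG); congr (_ - _).
  rewrite -scaler_sumr; congr (_ *: _).
  rewrite mulmx_sumr [RHS]big_nat_recl // ltnn scale0r add0r.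
  rewrite !big_nat; apply: eq_bigr => j /andP[j_gt0 _].
  by rewrite ltnS j_gt0 -scalemxAr exprS.
rewrite -scaler_sumr -scalerA; congr (_ *: _).
rewrite [RHS]big_nat_recr //= ltnn scale0r addr0.
rewrite scaler_sumr !big_nat; apply: eq_bigr => j /andP[_ ->].
by rewrite scalerA.
Qed.
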